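(* Let $\mathcal{S}=(s_n)_{n=0}^\infty$ be a sequence over $\{0,1\}$ that is not eventually periodic, and let $h(Y)=h_0+h_1Y+\ldots+h_dY^d\in\mathbb{Z}[Y]$ be a polynomial of degree $d$ without rational roots such that $h(G_{\mathcal{S}}(2))=0$, where $G_{\mathcal{S}}(2)=\sum_{n=0}^\infty s_n2^n\in\mathbb{Z}_2$. Put $H=\sum_{i=0}^d|h_i|$. Then for all $N\geq 1$, $$\frac{N}{d}-\frac{\log_2(H)}{d}\leq \lambda_{\mathcal{S}}(N)\leq \frac{d-1}{d}N+\frac{\log_2(H)}{d}+1.3.$$
   Context: $\mathbb{Z}_2$ denotes the ring of $2$-adic integers $\sum_{n\ge 0}a_n2^n$, $a_n\in\{0,1\}$, with convergence in the $2$-adic absolute value. For a binary sequence $\mathcal{S}=(s_n)_{n=0}^\infty$ and $N\ge1$, define $$\Lambda_{\mathcal{S}}(N)=\min\left\{\max\{|f|,q\}: f,q\in\mathbb{Z},\ q>0 \text{ odd},\ q\sum_{i=0}^{N-1}s_i2^i\equiv f \bmod 2^N\right\},$$ and the $N$th $2$-adic complexity $\lambda_{\mathcal{S}}(N)=\log_2\Lambda_{\mathcal{S}}(N)$. A sequence is eventually periodic if there exist $T\ge1$ and $n_0$ with $s_{n+T}=s_n$ for all $n\ge n_0$. *)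

(* Defs.v *)
From HB Require Import structures.
From mathcomp Require Import all_boot all_order all_algebra.
From mathcomp Require Import zify ring lra.
From mathcomp Require Import boolp classical_sets reals topology sequences exp.

Set Implicit Arguments.
Unset Strict Implicit.
Unset Printing Implicit Defensive.

Import Order.TTheory GRing.Theory Num.Theory.

Local Open Scope classical_set_scope.
Local Open Scope ring_scope.

(* Z_2 is built as the inverse limit of the rings Z/2^n: [res x n] is the
   representative in [0, 2^n) of x modulo 2^n.  The coherence condition also
   forces the range, since a remainder modulo 2^n lies in [0, 2^n).  The
   expansions sum_n a_n 2^n with digits in {0,1} are recovered in
   [Z2_expansion] below. *)
Record Z2 := MkZ2 {
  res :> nat -> int;
  res_coherent : forall n, res n = (res n.+1 %% (2 ^+ n))%Z }.

Lemma Z2_eq (x y : Z2) : (forall n, x n = y n) -> x = y.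
Proof.
case: x y => [x hx] [y hy] /= /funext xy; rewrite {x}xy in hx *.
by congr MkZ2; exact: Prop_irrelevance.
Qed.

HB.instance Definition _ := gen_eqMixin Z2.
HB.instance Definition _ := gen_choiceMixin Z2.

Lemma res_mod (x : Z2) n : (x n %% (2 ^+ n))%Z = x n.
Proof. by rewrite {1}res_coherent modz_mod -res_coherent. Qed.

Lemma res_modS (x : Z2) n : (x n.+1 = x n %[mod 2 ^+ n])%Z.
Proof. by rewrite [in RHS]res_coherent modz_mod. Qed.

Lemma modS_mod (a : int) n :
  ((a %% (2 ^+ n.+1))%Z %% (2 ^+ n))%Z = (a %% (2 ^+ n))%Z.
Proof.
by rewrite {2}(divz_eq a (2 ^+ n.+1)) exprS mulrA modzMDl.
Qed.

Section MkMod.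
Variables (u : nat -> int) (hu : forall n, (u n.+1 = u n %[mod 2 ^+ n])%Z).
Let modu n : (u n %% (2 ^+ n))%Z =
  ((u n.+1 %% (2 ^+ n.+1))%Z %% (2 ^+ n))%Z.
Proof. by rewrite modS_mod hu. Qed.
Definition Z2_of : Z2 := MkZ2 modu.
End MkMod.

Definition Z2_zero : Z2 := Z2_of (u := fun=> 0) (fun=> erefl).
Definition Z2_one : Z2 := Z2_of (u := fun=> 1) (fun=> erefl).

Lemma Z2_add_subproof (x y : Z2) n :
  (x n.+1 + y n.+1 = x n + y n %[mod 2 ^+ n])%Z.
Proof. by rewrite -modzDm !res_modS modzDm. Qed.
Definition Z2_add x y := Z2_of (Z2_add_subproof x y).

Lemma Z2_opp_subproof (x : Z2) n : (- x n.+1 = - x n %[mod 2 ^+ n])%Z.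
Proof. by rewrite -modzNm res_modS modzNm. Qed.
Definition Z2_opp x := Z2_of (Z2_opp_subproof x).

Lemma Z2_mul_subproof (x y : Z2) n :
  (x n.+1 * y n.+1 = x n * y n %[mod 2 ^+ n])%Z.
Proof. by rewrite -modzMm !res_modS modzMm. Qed.
Definition Z2_mul x y := Z2_of (Z2_mul_subproof x y).

Fact Z2_addA : associative Z2_add.
Proof. by move=> x y z; apply: Z2_eq => n /=; rewrite modzDmr modzDml addrA. Qed.
Fact Z2_addC : commutative Z2_add.
Proof. by move=> x y; apply: Z2_eq => n /=; rewrite addrC. Qed.
Fact Z2_add0 : left_id Z2_zero Z2_add.
Proof. by move=> x; apply: Z2_eq => n /=; rewrite modzDml add0r res_mod. Qed.
Fact Z2_addN : left_inverse Z2_zero Z2_opp Z2_add.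
Proof. by move=> x; apply: Z2_eq => n /=; rewrite modzDml addNr. Qed.

HB.instance Definition _ :=
  GRing.isZmodule.Build Z2 Z2_addA Z2_addC Z2_add0 Z2_addN.

Fact Z2_mulA : associative Z2_mul.
Proof. by move=> x y z; apply: Z2_eq => n /=; rewrite modzMmr modzMml mulrA. Qed.
Fact Z2_mulC : commutative Z2_mul.
Proof. by move=> x y; apply: Z2_eq => n /=; rewrite mulrC. Qed.
Fact Z2_mul1 : left_id Z2_one Z2_mul.
Proof. by move=> x; apply: Z2_eq => n /=; rewrite modzMml mul1r res_mod. Qed.
Fact Z2_mulD : left_distributive Z2_mul Z2_add.
Proof.
move=> x y z; apply: Z2_eq => n /=.
by rewrite modzMml modzDm mulrDl.
Qed.
Fact Z2_one_neq0 : Z2_one != 0 :> Z2.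
Proof. by apply/eqP => /(congr1 (fun x : Z2 => x 1)). Qed.

HB.instance Definition _ := GRing.Zmodule_isComNzRing.Build Z2
  Z2_mulA Z2_mulC Z2_mul1 Z2_mulD Z2_one_neq0.

Lemma res0 n : (0 : Z2) n = 0.
Proof. by rewrite /= mod0z. Qed.
Lemma res1 n : (1 : Z2) n = (1 %% (2 ^+ n))%Z.
Proof. by []. Qed.
Lemma resD (x y : Z2) n : (x + y) n = ((x n + y n)%R %% (2 ^+ n))%Z.
Proof. by []. Qed.
Lemma resN (x : Z2) n : (- x) n = ((- x n)%R %% (2 ^+ n))%Z.
Proof. by []. Qed.
Lemma resM (x y : Z2) n : (x * y) n = ((x n * y n)%R %% (2 ^+ n))%Z.
Proof. by []. Qed.

Lemma res_nat (k n : nat) : (k%:R : Z2) n = (k%:Z %% (2 ^+ n))%Z.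
Proof.
elim: k => [|k IH]; first by rewrite res0 mod0z.
by rewrite -natr1 resD IH res1 modzDm intS [in RHS]addrC.
Qed.

(* |x|_2 = 2^-v for the least v with x <> 0 modulo 2^(v+1), and |0|_2 = 0. *)
Definition abs2 (x : Z2) : rat :=
  if pselect (exists n, x n.+1 != 0) is left ex then 2 ^- ex_minn ex else 0.

Lemma abs2_ge0 x : 0 <= abs2 x.
Proof.
by rewrite /abs2; case: pselect => // ex; rewrite invr_ge0 exprn_ge0.
Qed.

Lemma le_expV2 (m n : nat) : (m <= n)%N -> (2 ^- n : rat) <= 2 ^- m.
Proof. by move=> mn; rewrite lef_pV2 ?posrE ?exprn_gt0// ler_eXn2l ?ltr1n. Qed.

Lemma abs2_ge (x : Z2) n : x n.+1 != 0 -> 2 ^- n <= abs2 x.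
Proof.
move=> xn; rewrite /abs2; case: pselect => [ex|nex].
  by case: ex_minnP => m _ /(_ _ xn) mn; exact: le_expV2.
by exfalso; apply: nex; exists n.
Qed.

Lemma abs2P (x : Z2) : abs2 x = 0 \/ exists2 n, x n.+1 != 0 & abs2 x = 2 ^- n.
Proof.
rewrite /abs2; case: pselect => [ex|]; last by left.
by right; case: ex_minnP => m xm _; exists m.
Qed.

Lemma res_le0 (x : Z2) m n : (m <= n)%N -> x n = 0 -> x m = 0.
Proof.
elim: n => [|n IH]; first by rewrite leqn0 => /eqP->.
rewrite leq_eqVlt => /orP[/eqP->//|mn] x0; apply: IH => //.
by rewrite res_coherent x0 mod0z.
Qed.

Lemma abs2_le (x : Z2) n : x n = 0 -> abs2 x <= 2 ^- n.
Proof.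
move=> xn; have [->|[m xm ->]] := abs2P x; first by rewrite invr_ge0 exprn_ge0.
apply: le_expV2; rewrite leqNgt; apply/negP => mn.
by move/eqP: xm; apply; exact: res_le0 xn.
Qed.

Lemma abs2_eq0 x : abs2 x = 0 -> x = 0.
Proof.
move=> x0; apply: Z2_eq => n; rewrite res0.
suff : x n.+1 = 0 by apply: res_le0.
apply/eqP; apply: contraT => /abs2_ge; rewrite x0 leNgt.
by rewrite invr_gt0 exprn_gt0.
Qed.

Lemma abs20 : abs2 0 = 0.
Proof. by have [//|[n]] := abs2P 0; rewrite res0 eqxx. Qed.

Lemma resN_eq0 (x : Z2) n : ((- x) n == 0) = (x n == 0).
Proof.
have h (y : Z2) : y n = 0 -> (- y : Z2) n = 0 by rewrite resN => ->; rewrite oppr0 mod0z.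
by apply/eqP/eqP => [/h|/h//]; rewrite opprK.
Qed.

Lemma abs2N x : abs2 (- x) = abs2 x.
Proof.
have le y : abs2 (- y) <= abs2 y.
  have [->|[n yn ->]] := abs2P (- y); first exact: abs2_ge0.
  by apply: abs2_ge; rewrite resN_eq0 in yn.
by apply/eqP; rewrite eq_le le /= -{1}[x]opprK le.
Qed.

Lemma abs2D x y : abs2 (x + y) <= Num.max (abs2 x) (abs2 y).
Proof.
have [->|[n xyn ->]] := abs2P (x + y); first by rewrite le_max abs2_ge0.
have [x0|xn] := eqVneq (x n.+1) 0; last by rewrite le_max abs2_ge.
have [y0|yn] := eqVneq (y n.+1) 0; last by rewrite le_max (abs2_ge yn) orbT.
by move: xyn; rewrite resD x0 y0 addr0 mod0z eqxx.
Qed.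

Definition dist2 (x y : Z2) : rat := abs2 (x - y).

Fact dist2xx x : dist2 x x = 0.
Proof. by rewrite /dist2 subrr abs20. Qed.
Fact dist2_positivity x y : dist2 x y = 0 -> x = y.
Proof. by move/abs2_eq0/eqP; rewrite subr_eq0 => /eqP. Qed.
Fact dist2_sym x y : dist2 x y = dist2 y x.
Proof. by rewrite /dist2 -abs2N opprB. Qed.
Fact dist2_triangle y x z : dist2 x z <= dist2 x y + dist2 y z.
Proof.
rewrite /dist2 -(subrKA y); apply: le_trans (abs2D _ _) _.
by rewrite ge_max lerDl lerDr !abs2_ge0.
Qed.

HB.instance Definition _ := isPointed.Build Z2 0.
HB.instance Definition _ := @isMetric.Build rat Z2 dist2
  dist2xx dist2_positivity dist2_sym dist2_triangle.

(* The limit is taken in the metric |x - y|_2; it exists by [cvg_G2], and [G2_res]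
   identifies it. *)
Definition G2 (s : nat -> bool) : Z2 :=
  limn (series (fun n => (s n)%:R * 2 ^+ n : Z2)).

Definition psum (s : nat -> bool) (N : nat) : int :=
  \sum_(i < N) (s i)%:R * 2 ^+ i.

Lemma psumS s N : psum s N.+1 = psum s N + (s N)%:R * 2 ^+ N.
Proof. by rewrite /psum big_ord_recr. Qed.

Lemma psum_mod s n : (psum s n.+1 = psum s n %[mod 2 ^+ n])%Z.
Proof. by rewrite psumS addrC modzMDl. Qed.

Lemma psum_range s n : 0 <= psum s n < 2 ^+ n.
Proof.
elim: n => [|n]; first by rewrite /psum big_ord0.
rewrite psumS exprS; set p := psum s n; set e := 2 ^+ n.
by case: (s n); lia.
Qed.

Lemma psum_small s n : (psum s n %% (2 ^+ n))%Z = psum s n.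
Proof. exact/modz_small/psum_range. Qed.

Lemma series_res (s : nat -> bool) N n :
  (series (fun n => (s n)%:R * 2 ^+ n : Z2)) N n = (psum s N %% (2 ^+ n))%Z.
Proof.
elim: N => [|N IH].
  by rewrite /series /= big_geq// res0 /psum big_ord0 mod0z.
rewrite psumS seriesSr resD.
have E : 2 ^+ N = (2 ^ N)%:R :> Z2 by rewrite natrX.
by rewrite IH resM E !res_nat modzMm modzDm -!natz natrX.
Qed.

Lemma cvg_digits (s : nat -> bool) :
  series (fun n => (s n)%:R * 2 ^+ n : Z2) @ \oo --> Z2_of (psum_mod s).
Proof.
apply/(@metricType_numDomainType.cvgrPdist_lt rat Z2) => e e0.
have [n en] : exists n : nat, (2 ^- n : rat) < e.
  exists (Num.bound e^-1); rewrite invf_plt ?posrE ?exprn_gt0//.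
  apply: (@lt_trans _ _ (Num.bound e^-1)%:R).
    by apply: archi_boundP; rewrite invr_ge0 ltW.
  by rewrite -natrX ltr_nat ltn_expl.
near=> N.
apply: le_lt_trans en; apply: abs2_le.
rewrite resD resN series_res modzNm modzDmr modzDml /=.
have nN : (n <= N)%N by near: N; exact: nbhs_infty_ge.
rewrite -(subnKC nN); elim: (N - n)%N => [|k IH].
  by rewrite addn0 subrr mod0z.
rewrite addnS psumS opprD addrA exprD mulrCA -modzDm IH add0r modz_mod.
by rewrite -mulrN modzMr.
Unshelve. all: by end_near. Qed.

Lemma G2E s : G2 s = Z2_of (psum_mod s).
Proof. exact: (cvg_lim (@metric_hausdorff rat Z2) (cvg_digits (s:=s))). Qed.

Lemma cvg_G2 (s : nat -> bool) : series (fun n => (s n)%:R * 2 ^+ n : Z2) @ \oo --> G2 s.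
Proof. rewrite G2E; exact: cvg_digits. Qed.

Lemma G2_res s n : G2 s n = psum s n.
Proof. by rewrite G2E /= psum_small. Qed.

Lemma Z2_expansion (x : Z2) : exists! s : nat -> bool, x = G2 s.
Proof.
pose s n := x n.+1 != x n.
exists s; split; last first.
  move=> t xt; apply/funext => n; rewrite /s xt !G2_res psumS.
  by case: (t n); rewrite ?mul1r ?mul0r ?addr0 ?eqxx// -subr_eq0 addrC addKr
    expf_eq0 andbF.
apply: Z2_eq => n; rewrite G2_res; elim: n => [|n IH].
  by rewrite /psum big_ord0 res_coherent expr0 modz1.
rewrite psumS -IH /s.
have x0 := res_coherent x n; have x1 := esym (res_mod x n.+1).
have e0 : 0 < (2 : int) ^+ n by rewrite exprn_gt0.
have q1 := divz_eq (x n.+1) (2 ^+ n).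
have r1 : 0 <= x n.+1 < 2 ^+ n.+1.
  by rewrite x1 modz_ge0 ?ltz_pmod// ?gt_eqF// exprn_gt0.
have r0 : 0 <= x n < 2 ^+ n by rewrite x0 modz_ge0 ?ltz_pmod// gt_eqF.
rewrite -x0 in q1; move: r1 r0 q1; rewrite exprS.
move: {x0 x1} e0 (x n.+1 %/ 2 ^+ n)%Z.
move: (2 ^+ n) (x n.+1) (x n) => e a b e0 q r1 r0 ab.
have [q0|q1] : q = 0 \/ q = 1 by nia.
- by rewrite ab q0 mul0r add0r eqxx mul0r addr0.
- rewrite ab q1 mul1r; case: eqP => [|_]; first by lia.
  by rewrite mul1r addrC.
Qed.

Definition eventually_periodic (s : nat -> bool) : Prop :=
  exists T n0 : nat, (1 <= T)%N /\ forall n, (n0 <= n)%N -> s (n + T)%N = s n.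

(* The integers m over which Lambda_S(N) is the minimum; they are natural numbers
   since q > 0. *)
Definition admissible_height (s : nat -> bool) (N m : nat) : Prop :=
  exists f q : int, [/\ 0 < q, odd `|q|%N,
    (q * psum s N = f %[mod 2 ^+ N])%Z & m%:Z = Num.max `|f| q].

Lemma admissible_height_ex s N : exists m, `[< admissible_height s N m >].
Proof.
exists (absz (Num.max `|psum s N| 1)); apply/asboolP; exists (psum s N), 1.
by split=> //; rewrite ?mul1r// gez0_abs// le_max ler01 orbT.
Qed.

Definition Lambda (s : nat -> bool) (N : nat) : nat :=
  ex_minn (admissible_height_ex s N).

Definition log2 (R : realType) (x : R) : R := ln x / ln 2.

Definition lambda (R : realType) (s : nat -> bool) (N : nat) : R :=
  log2 (Lambda s N)%:R.

(* Main.v *)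
(* Let L be the lattice of pairs (f, q) with q S = f modulo 2^N, where S is the
   N-th partial sum, and let P be the homogenization of h.  On L we have
   P(f, q) = q^d h(S) = 0 modulo 2^N, while P has no nontrivial integer zero
   since h has no rational root; so every nonzero vector w of L, whatever the
   parity of q, satisfies 2^N <= H |w|^d.  This is the lower bound.  For the
   upper bound, Euclid's algorithm on (2^N, S) yields two consecutive vectors
   v, w of L with |v| |w| <= 2^N, and one of them, say v, has q odd.  Hence
   Lambda <= |v| <= 2^N / |w|, to which the lower bound for w applies. *)
Require Import Defs.
From mathcomp Require Import all_boot all_order all_algebra.
From mathcomp Require Import reals.
From mathcomp Require Import zify ring lra boolp exp.

Import Order.TTheory GRing.Theory Num.Theory.
Local Open Scope ring_scope.

(** The sup norm |w| of a lattice vector; q enters in absolute value because vectors with q <= 0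
    occur too. *)
Definition height (f q : int) : nat := maxn `|f| `|q|.

Lemma height_signl (e a p : int) : e ^+ 2 = 1 -> 0 <= p <= a ->
  height a (e * p) = `|a|%N.
Proof.
by move=> /eqP; rewrite sqrf_eq1 /height => /orP[] /eqP ->; lia.
Qed.

Lemma height_signr (e b q : int) : e ^+ 2 = 1 -> 0 <= b <= q ->
  height b (e * q) = `|q|%N.
Proof.
by move=> /eqP; rewrite sqrf_eq1 /height => /orP[] /eqP ->; lia.
Qed.

Lemma odd_sign (e q : int) : e ^+ 2 = 1 -> odd `|e * q| = odd `|q|.
Proof.
by move=> /eqP; rewrite sqrf_eq1 => /orP[] /eqP ->; rewrite ?mulN1r ?abszN ?mul1r.
Qed.

Definition in_lattice (M x f q : int) : Prop := (q * x = f %[mod M])%Z.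

(* Invariant of Euclid's algorithm on M and x: the remainders b < a have
   cofactors of opposite signs and absolute values p, q.  We stop as soon as
   b < q; then a and q are the two heights. *)
Lemma euclid_short_pair (M x a b p q e : int) :
  0 <= p -> 0 < q -> 0 <= b < a -> p <= a -> a * q + b * p = M ->
  odd `|p| || odd `|q| -> e ^+ 2 = 1 ->
  in_lattice M x a (e * p) -> in_lattice M x b (- e * q) ->
  exists f1 q1 f2 q2 : int,
    [/\ in_lattice M x f1 q1, in_lattice M x f2 q2, odd `|q1|,
        (f2 != 0) || (q2 != 0) & (height f1 q1 * height f2 q2)%:Z <= M].
Proof.
have [n] := ubnP `|b|%N.
elim: n a b p q e => // n IH a b p q e bn p0 q0 /andP[b0 ba] pa aqbp pq e2 La Lb.
have Ne2 : (- e) ^+ 2 = 1 by rewrite sqrrN.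
have [qb|bq] := lerP q b; last first.
  have ha : height a (e * p) = `|a|%N by rewrite height_signl // p0.
  have hb : height b (- e * q) = `|q|%N by rewrite height_signr // b0 ltW.
  have a0 : 0 < a by exact: le_lt_trans ba.
  have haqM : (`|a|%N * `|q|%N)%:Z <= M.
    by rewrite PoszM !gtz0_abs // -aqbp lerDl mulr_ge0.
  (* Either cofactor may be the odd one; the vector carrying it is listed first. *)
  have [oq|eq] := boolP (odd `|q|).
    exists b, (- e * q), a, (e * p); split => //.
    - by rewrite odd_sign.
    - by rewrite gt_eqF.
    - by rewrite ha hb mulnC.
  exists a, (e * p), b, (- e * q); split => //.
  - by rewrite odd_sign //; move: pq; rewrite (negbTE eq) orbF.
  - rewrite mulf_eq0 (gt_eqF q0) orbF; apply/orP; right.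
    by rewrite -sqrf_eq0 Ne2.
  - by rewrite ha hb.
have b_gt0 : 0 < b by exact: lt_le_trans qb.
have k0 : 0 < (a %/ b)%Z by rewrite gtz0_ge1 lez_divRL // mul1r ltW.
have r0 : 0 <= (a %% b)%Z by rewrite modz_ge0 // gt_eqF.
have rb := ltz_pmod a b_gt0.
have ab := divz_eq a b.
move: (a %/ b)%Z (a %% b)%Z k0 r0 rb ab => k r k0 r0 rb ab.
(* Up to sign, [a * q + b * p] is the determinant of the two vectors, so a division step preserves
   it. *)
have det : b * (p + k * q) + r * q = M by rewrite -aqbp ab; ring.
apply: (IH b r q (p + k * q) (- e)) => //.
- by move: bn r0 rb b0; clear; lia.
- exact: ltW.
- by rewrite ltr_wpDl // mulr_gt0.
- by rewrite r0.
(* If q is even, then p is odd and [p + k * q] has the parity of p. *)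
- move: pq; have [_|] //= := boolP (odd `|q|); rewrite orbF => eq op.
  have [j ->] : exists j : int, q = 2 * j.
    by exists (q %/ 2)%Z; move: eq; clear; lia.
  by rewrite mulrCA; move: (k * j) op => z; clear; lia.
- rewrite /in_lattice in La Lb *.
  have -> : - - e * (p + k * q) * x = e * p * x + - k * (- e * q * x) by ring.
  have -> : r = a + - k * b by rewrite ab; ring.
  by rewrite -[LHS]modzDm La -[in LHS]modzMmr Lb modzMmr modzDm.
Qed.

Lemma short_pair (M x : int) : 0 <= x < M ->
  exists f1 q1 f2 q2 : int,
    [/\ in_lattice M x f1 q1, in_lattice M x f2 q2, odd `|q1|,
        (f2 != 0) || (q2 != 0) & (height f1 q1 * height f2 q2)%:Z <= M].
Proof.
(* Euclid starts from the vectors (M, 0) and (x, 1); [e = -1] makes the second cofactor +1. *)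
move=> /andP[x0 xM]; apply: (@euclid_short_pair M x M x 0 1 (-1)) => //.
- by rewrite x0.
- exact: le_trans (ltW xM).
- by rewrite mulr1 mulr0 addr0.
- by rewrite /in_lattice mulr0 mul0r mod0z modzz.
- by rewrite /in_lattice opprK !mul1r.
Qed.

Definition homog (h : {poly int}) (f q : int) : int :=
  \sum_(i < size h) h`_i * (f ^+ i * q ^+ ((size h).-1 - i)).

Lemma homogM (h : {poly int}) (x q : int) :
  homog h (q * x) q = q ^+ (size h).-1 * h.[x].
Proof.
rewrite /homog horner_coef mulr_sumr; apply: eq_bigr => i _.
have /subnKC <- : (i <= (size h).-1)%N by have := ltn_ord i; lia.
by rewrite addKn exprMn exprD; ring.
Qed.

Lemma homog_mod (h : {poly int}) (M f g q : int) :
  (f = g %[mod M])%Z -> (homog h f q = homog h g q %[mod M])%Z.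
Proof.
move=> fg; rewrite /homog.
apply: (big_ind2 (fun u v => (u = v %[mod M])%Z)) => // [u v u' v' uv uv'|i _].
  by rewrite -modzDm uv uv' modzDm.
have fgi : (f ^+ i = g ^+ i %[mod M])%Z by rewrite -modzXm fg modzXm.
by rewrite !(mulrCA h`_i) -[LHS]modzMml fgi modzMml.
Qed.

(** For q = 0 only the leading term survives; otherwise the value is q^d h(f/q), and f/q is not a
    root. *)
Lemma homog_neq0 (h : {poly int}) (f q : int) :
  (forall x : rat, ~~ root (map_poly intr h) x) ->
  (f != 0) || (q != 0) -> homog h f q != 0.
Proof.
move=> noroot; have h0 : h != 0.
  by apply: contraNneq (noroot 0) => ->; rewrite rmorph0 root0.
have [->|q0 _] := eqVneq q 0.
  rewrite orbF => f0; rewrite /homog.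
  have := size_poly_eq0 h; rewrite (negbTE h0); case hs : (size h) => [|n] // _.
  rewrite big_ord_recr big1 => [|i _] /=; last first.
    by rewrite expr0n subn_eq0 leqNgt ltn_ord !mulr0.
  rewrite add0r subnn expr0 mulr1 mulf_neq0 ?expf_neq0 //.
  by have := lead_coef_eq0 h; rewrite lead_coefE hs /= => ->.
apply: contra (noroot (f%:~R / q%:~R)) => /eqP hom0; rewrite /root.
have qQ0 : q%:~R != 0 :> rat by rewrite intr_eq0.
suff /eqP : q%:~R ^+ (size h).-1 * (map_poly intr h).[f%:~R / q%:~R] = 0 :> rat.
  by rewrite mulf_eq0 expf_eq0 (negbTE qQ0) andbF.
transitivity ((homog h f q)%:~R : rat); last by rewrite hom0.
rewrite /homog rmorph_sum /= horner_coef mulr_sumr size_map_inj_poly //;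
  last exact: intr_inj.
apply: eq_bigr => i _; rewrite coef_map /= !rmorphM !rmorphXn /=.
have ile : (i <= (size h).-1)%N by rewrite -ltnS (ltn_predK (ltn_ord i)) ltn_ord.
rewrite -{1}(subnKC ile) exprD expr_div_n; field; exact: expf_neq0.
Qed.

Lemma homog_le (h : {poly int}) (f q : int) :
  `|homog h f q| <=
    (\sum_(i < size h) `|h`_i|) * (height f q)%:Z ^+ (size h).-1.
Proof.
apply: le_trans (ler_norm_sum _ _ _) _; rewrite mulr_suml.
apply: ler_sum => i _; rewrite normrM ler_wpM2l // normrM !normrX.
have ile : (i <= (size h).-1)%N by have := ltn_ord i; lia.
rewrite -{2}(subnKC ile) exprD ler_pM ?exprn_ge0 // lerXn2r ?nnegrE //;
  rewrite /height; lia.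
Qed.

Lemma res_int (c : int) n : (c%:~R : Z2) n = (c %% 2 ^+ n)%Z.
Proof.
case: c => k; first by rewrite -[_%:~R]/(k%:R) res_nat.
by rewrite NegzE mulrNz resN -[_%:~R]/(k.+1%:R) res_nat modzNm.
Qed.

(** Reduction modulo 2^n respects sums and products. This turns the 2-adic equation for [G2 s] into
    congruences for its partial sums. *)
Lemma res_horner (h : {poly int}) (x : Z2) n :
  (map_poly intr h).[x] n = (h.[x n] %% 2 ^+ n)%Z.
Proof.
elim/poly_ind: h => [|h c IH]; first by rewrite rmorph0 !horner0 res0 mod0z.
rewrite rmorphD rmorphM /= map_polyX map_polyC /= !hornerMXaddC.
by rewrite resD resM IH res_int modzMml modzDm.
Qed.

Lemma height_lower_bound (s : nat -> bool) (h : {poly int}) (N : nat) (f q : int) :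
  (forall x : rat, ~~ root (map_poly intr h) x) ->
  (map_poly intr h : {poly Z2}).[G2 s] = 0 ->
  in_lattice (2 ^+ N) (psum s N) f q -> (f != 0) || (q != 0) ->
  2 ^+ N <= (\sum_(i < size h) `|h`_i|) * (height f q)%:Z ^+ (size h).-1.
Proof.
move=> noroot hG2 qf fq0; apply: le_trans (homog_le h f q).
have hom0 := homog_neq0 h f q noroot fq0.
have /dvdzP[k hk] : (2 ^+ N %| homog h f q)%Z.
  (* Replacing f by q S, with S the partial sum, leaves q^d h(S), and h(S) is the residue of h(G2 s)
     = 0. *)
  apply/dvdz_mod0P; rewrite -(homog_mod h _ _ _ q qf) homogM.
  by rewrite -modzMmr -G2_res -res_horner hG2 res0 mulr0 mod0z.
have k0 : k != 0 by apply: contra_neq hom0; rewrite hk => ->; rewrite mul0r.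
rewrite hk normrM normrX ler_peMl ?exprn_ge0 //; lia.
Qed.

Lemma Lambda_le (s : nat -> bool) (N : nat) (f q : int) :
  odd `|q| -> in_lattice (2 ^+ N) (psum s N) f q -> (Lambda s N <= height f q)%N.
Proof.
move=> oq qf; rewrite /Lambda; case: ex_minnP => m _; apply.
apply/asboolP; have [q0|q0] := ltrP 0 q.
  by exists f, q; split => //; rewrite /height; lia.
(* Oddness excludes q = 0; for q < 0 the opposite vector has the same height and a positive
   denominator. *)
exists (- f), (- q); split; [lia|lia| |rewrite /height; lia].
by rewrite mulNr -[LHS]modzNm qf modzNm.
Qed.

Lemma LambdaP (s : nat -> bool) (N : nat) :
  exists f q : int, [/\ q != 0, in_lattice (2 ^+ N) (psum s N) f q
    & Lambda s N = height f q].
Proof.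
rewrite /Lambda; case: ex_minnP => m /asboolP[f [q [q0 _ qf mE]]] _.
by exists f, q; split => //; [lia|rewrite /height; lia].
Qed.

Theorem theorem1 (R : realType) (s : nat -> bool) (d : nat) (h : {poly int})
  (s_aperiodic : ~ eventually_periodic s)
  (deg_h : size h = d.+1)
  (h_noroot : forall x : rat, ~~ root (map_poly intr h) x)
  (h_G2 : (map_poly intr h : {poly Z2}).[G2 s] = 0) :
  let H : int := \sum_(i < d.+1) `|h`_i| in
  forall N : nat, (1 <= N)%N ->
    N%:R / d%:R - log2 (H%:~R : R) / d%:R <= lambda R s N
    /\ lambda R s N
         <= (d%:R - 1) / d%:R * N%:R + log2 (H%:~R : R) / d%:R + 13%:R / 10%:R.
Proof.
move=> H N _.
have lower (n : nat) (f q : int) : in_lattice (2 ^+ n) (psum s n) f q ->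
    (f != 0) || (q != 0) -> 2 ^+ n <= H * (height f q)%:Z ^+ d.
  by move=> qf fq0; have := height_lower_bound s h n f q h_noroot h_G2 qf fq0; rewrite deg_h.
have d0 : (0 < d)%N.
  rewrite lt0n; apply/eqP => d0.
  (* For d = 0 the lower bound would read 2^n <= H for every n, which fails at n = |H|. *)
  have [f [q [q0 qf _]]] := LambdaP s `|H|%N.
  have := lower _ _ _ qf; rewrite q0 orbT d0 expr0 mulr1 => /(_ isT).
  have := ltn_expl `|H|%N (isT : (1 < 2)%N).
  rewrite (_ : 2 ^+ `|H|%N = (2 ^ `|H|)%N%:Z); last by rewrite -natz natrX.
  by move: (2 ^ _)%N; clear -H; lia.
have [f [q [q0 qf LE]]] := LambdaP s N.
have L0 : (0 < Lambda s N)%N by rewrite LE /height; lia.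
have lowerL : 2 ^+ N <= H * (Lambda s N)%:Z ^+ d.
  by rewrite LE; apply: lower; rewrite ?q0 ?orbT.
have H0 : 0 < H.
  rewrite -(pmulr_lgt0 _ (_ : 0 < (Lambda s N)%:Z ^+ d)) ?exprn_gt0 //.
  by apply: lt_le_trans lowerL; rewrite exprn_gt0.
(* With w the second short vector, Lambda^d 2^N <= H (Lambda |w|)^d, and Lambda |w| <= 2^N. *)
have upperL : (Lambda s N)%:Z ^+ d * 2 ^+ N <= H * (2 ^+ N) ^+ d.
  have [f1 [q1 [f2 [q2 [L1 L2 oq1 nz2 le]]]]] := short_pair _ _ (psum_range s N).
  apply: le_trans (_ : (Lambda s N)%:Z ^+ d * (H * (height f2 q2)%:Z ^+ d) <= _).
    by rewrite ler_wpM2l ?exprn_ge0 // lower.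
  rewrite mulrCA ler_wpM2l ?(ltW H0) // -exprMn lerXn2r ?nnegrE ?exprn_ge0 //.
  apply: le_trans le; have := Lambda_le s N f1 q1 oq1 L1; nia.
have ln2 : 0 < ln 2 :> R by rewrite ln_gt0 // ltr1n.
have HR : 0 < H%:~R :> R by rewrite ltr0z.
have LR : 0 < (Lambda s N)%:R :> R by rewrite ltr0n.
have dR : 0 < d%:R :> R by rewrite ltr0n.
have lnLe (x y : int) : 0 < x -> x <= y -> ln (x%:~R : R) <= ln y%:~R.
  by move=> x0 xy; rewrite ler_ln ?posrE ?ltr0z ?ler_int // (lt_le_trans x0).
have ln2X n : ln ((2 ^+ n : int)%:~R : R) = ln 2 * n%:R.
  by rewrite rmorphXn /= lnXn ?ltr0n // mulr_natr.
have lnLX : ln (((Lambda s N)%:Z ^+ d)%:~R : R) = ln (Lambda s N)%:R * d%:R.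
  by rewrite rmorphXn /= lnXn // mulr_natr.
have := lnLe _ _ (exprn_gt0 N (isT : 0 < 2 :> int)) lowerL.
have := lnLe _ _ _ upperL; rewrite mulr_gt0 ?exprn_gt0 // => /(_ isT).
rewrite !rmorphM /= !lnM ?posrE ?ltr0z ?exprn_gt0 // -exprM !ln2X lnLX natrM.
rewrite /lambda /log2.
(* Taking logarithms has left two linear facts: t N <= e + d l and d l + t N <= e + t N d. *)
move: (ln _%:R) (ln H%:~R) (ln 2) ln2 => l e t t0 up lo.
split.
  rewrite -mulrBl ler_pdivrMr // -(ler_pM2r t0).
  suff -> : (N%:R - e / t) * t = t * N%:R - e by rewrite mulrAC divfK ?gt_eqF //; lra.
  by field; rewrite gt_eqF.
(* The second fact gives the upper bound with additive constant 0, and 1.3 is positive. *)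
apply: (@le_trans _ _ (((d%:R - 1) * N%:R + e / t) / d%:R)); last first.
  suff -> : (d%:R - 1) / d%:R * N%:R + e / t / d%:R = ((d%:R - 1) * N%:R + e / t) / d%:R by lra.
  by field; rewrite !gt_eqF.
rewrite ler_pdivlMr // -(ler_pM2r t0) mulrAC divfK ?gt_eqF //.
suff -> : ((d%:R - 1) * N%:R + e / t) * t = t * (N%:R * d%:R) - t * N%:R + e by lra.
by field; rewrite gt_eqF.
Qed.
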